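(* Let $A,B\in\mathbb{C}_{n,n}$. Then $A\mathop{\le}\limits^{\mathrm{WG}}B$ if and only if there exists a unitary matrix $\widehat{U}$ such that $$A=\widehat{U}\begin{bmatrix}T&\widehat{S}_1&\widehat{S}_2\\0&N_{11}&N_{12}\\0&N_{21}&N_{22}\end{bmatrix}\widehat{U}^\ast,\qquad B=\widehat{U}\begin{bmatrix}T&\widehat{S}_1-T^{-1}\widehat{S}_1T_1&\widehat{S}_2-T^{-1}\widehat{S}_1S_1\\0&T_1&S_1\\0&0&N_2\end{bmatrix}\widehat{U}^\ast,$$ where $T$ and $T_1$ are invertible, and $\begin{bmatrix}N_{11}&N_{12}\\N_{21}&N_{22}\end{bmatrix}$ and $N_2$ are nilpotent.
   Context: $\mathbb{C}_{n,n}$ is the set of complex $n\times n$ matrices and $A^\ast$ the conjugate transpose. The block partitions are conformal with square diagonal blocks (blocks may be empty); $\widehat{S}_1,\widehat{S}_2,S_1$ are otherwise arbitrary matrices of appropriate size. The index $\mathrm{Ind}(A)$ is the smallest positive integer $k$ with $\mathrm{rk}(A^{k+1})=\mathrm{rk}(A^k)$. Core-EP decomposition (known): every $A\in\mathbb{C}_{n,n}$ with $\mathrm{Ind}(A)=k$ can be written uniquely as $A=A_1+A_2$ with $\mathrm{Ind}(A_1)=1$, $A_2^k=0$ and $A_1^\ast A_2=A_2A_1=0$ (one or both may be null). For a matrix $M$ of index one, the group inverse $M^\#$ is the unique $X$ with $XM^2=M$, $XMX=X$, $MX=XM$. The sharp partial order on matrices of index one: $M\mathop{\le}\limits^{\#}M'$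 means $MM^\#=M'M^\#$ and $M^\#M=M^\#M'$. The WG order: $A\mathop{\le}\limits^{\mathrm{WG}}B$ means $A_1\mathop{\le}\limits^{\#}B_1$, where $A=A_1+A_2$ and $B=B_1+B_2$ are the core-EP decompositions. *)

(* Defs.v *)
From HB Require Import structures.
From mathcomp Require Export all_boot all_order all_algebra.
From mathcomp Require Export reals complex.

#[export] Set Implicit Arguments.
#[export] Unset Strict Implicit.
#[export] Unset Printing Implicit Defensive.
Import Order.TTheory GRing.Theory Num.Theory.
Local Open Scope ring_scope.
Local Open Scope sesquilinear_scope.

Lemma mxrank_exp_stable (F : fieldType) (n : nat) (A : 'M[F]_n) :
  exists k, (0 < k)%N && (\rank (A ^+ k.+1) == \rank (A ^+ k)).
Proof.
suff H m k : (0 < k)%N -> (\rank (A ^+ k) < m)%N ->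
    exists l, (0 < l)%N && (\rank (A ^+ l.+1) == \rank (A ^+ l)).
  exact: (H _ 1%N isT (ltnSn _)).
elim: m k => [//|m IHm] k k_gt0 ltm.
have [eq_rk | neq_rk] := eqVneq (\rank (A ^+ k.+1)) (\rank (A ^+ k)).
  by exists k; rewrite k_gt0 eq_rk eqxx.
apply: (IHm k.+1) => //; apply: leq_trans (_ : (\rank (A ^+ k) <= m)%N) => //.
by rewrite ltn_neqAle neq_rk exprS mxrankM_maxr.
Qed.

(* Since k is required to be positive, nonsingular matrices and the null
   matrix have index 1. *)
Definition mxindex (F : fieldType) (n : nat) (A : 'M[F]_n) : nat :=
  ex_minn (mxrank_exp_stable A).

Definition nilpotent_mx (F : fieldType) (n : nat) (A : 'M[F]_n) : Prop :=
  exists k : nat, A ^+ k = 0.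

Definition core_EP_decomposition (C : numClosedFieldType) (n : nat)
    (A A1 A2 : 'M[C]_n) : Prop :=
  [/\ A = A1 + A2, mxindex A1 = 1%N, A2 ^+ mxindex A = 0,
      A1 ^t* *m A2 = 0 & A2 *m A1 = 0].

Definition is_group_inverse (F : fieldType) (n : nat) (M X : 'M[F]_n) : Prop :=
  [/\ X *m (M ^+ 2) = M, X *m M *m X = X & M *m X = X *m M].

Lemma group_inverse_unique (F : fieldType) (n : nat) (M X Y : 'M[F]_n) :
  is_group_inverse M X -> is_group_inverse M Y -> X = Y.
Proof.
move=> [X1 X2 X3] [Y1 Y2 Y3].
have MXM : X *m M *m M = M by rewrite -mulmxA -[M *m M]/(M ^+ 2).
have MYM : Y *m M *m M = M by rewrite -mulmxA -[M *m M]/(M ^+ 2).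
have XMYM : X *m M = Y *m M.
  by rewrite -{1}MYM -Y3 -!mulmxA -Y3 !mulmxA MXM Y3.
by rewrite -X2 XMYM -mulmxA X3 XMYM -Y3 mulmxA Y2.
Qed.

(* The sharp order, on matrices of index one; X is the group inverse of M. *)
Definition sharp_le (F : fieldType) (n : nat) (M M' : 'M[F]_n) : Prop :=
  [/\ mxindex M = 1%N, mxindex M' = 1%N &
      exists X : 'M[F]_n,
        [/\ is_group_inverse M X, M *m X = M' *m X & X *m M = X *m M']].

(* Every matrix has exactly one core-EP decomposition, so the quantifier below
   just names the components A1 and B1. *)
Definition WG_le (C : numClosedFieldType) (n : nat) (A B : 'M[C]_n) : Prop :=
  exists A1 A2 B1 B2 : 'M[C]_n,
    [/\ core_EP_decomposition A A1 A2, core_EP_decomposition B B1 B2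
      & sharp_le A1 B1].

(* The partitioned matrix
     [ A11 A12 A13 ]
     [ A21 A22 A23 ]
     [ A31 A32 A33 ]
   with square diagonal blocks of sizes p, q, r, as an n x n matrix. *)
Definition block3_mx (F : fieldType) (n p q r : nat) (e : (p + (q + r) = n)%N)
    (A11 : 'M[F]_(p, p)) (A12 : 'M[F]_(p, q)) (A13 : 'M[F]_(p, r))
    (A21 : 'M[F]_(q, p)) (A22 : 'M[F]_(q, q)) (A23 : 'M[F]_(q, r))
    (A31 : 'M[F]_(r, p)) (A32 : 'M[F]_(r, q)) (A33 : 'M[F]_(r, r)) : 'M[F]_n :=
  castmx (e, e)
    (block_mx A11 (row_mx A12 A13)
              (col_mx A21 A31) (block_mx A22 A23 A32 A33)).

(* Main.v *)
Require Import Defs.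
From mathcomp Require Import all_boot all_order all_algebra.
From mathcomp Require Import reals complex.
Import Order.TTheory GRing.Theory Num.Theory.
Local Open Scope ring_scope.
Local Open Scope sesquilinear_scope.

(** The relation is invariant under a simultaneous unitary similarity of [A]
and [B], so a good orthonormal basis may be chosen.

A matrix of index one has its column space as a complement of its kernel.  In
an orthonormal basis that begins with a basis of the column space of [A1] it
becomes [T S; 0 0], and the index condition says precisely that [T] is
invertible ([index1_unitary_block]).  The sharp order is equivalent to the
commutation relations [A1 B1 = B1 A1 = A1 A1] ([sharp_leP]); in the chosen
basis these are linear equations for the blocks of [B1], whose solutions are
the matrices [T X; 0 Y] with [X = S - T^-1 S Y] ([sharp_le_ublock_mx]).  This
is where the correction terms of the canonical form come from.

An invertible leading block can be stripped from a core-EP decomposition: if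
the first part is [T X; 0 Y], the orthogonality relations force the second part
to vanish outside its last diagonal block, and the remaining corners form a
core-EP decomposition with first part [Y] ([core_EP_decomposition_ublock_mx]).
For [A], where [Y = 0], this leaves a nilpotent block.  For [B], the block [Y]
has index one again, so a second unitary change of basis, acting on the last
coordinates only, gives it the form [T1 S1; 0 0], and stripping [T1] leaves the
nilpotent block [N2].  The descriptions of both relations are equivalences, so
reading them backwards gives the converse. *)

(** * The index *)

(** Ranks at different sizes may be compared here: this is what lets the index
of a block triangular matrix be read off from one diagonal block. *)
Lemma eq_mxindex (F : fieldType) (m n : nat) (A : 'M[F]_m) (B : 'M[F]_n) :
    (forall k, (\rank (A ^+ k.+1) == \rank (A ^+ k)) =
               (\rank (B ^+ k.+1) == \rank (B ^+ k))) ->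
  mxindex A = mxindex B.
Proof. by move=> eqAB; apply: eq_ex_minn => k; rewrite eqAB. Qed.

Lemma mxindex_gt0 (F : fieldType) (n : nat) (A : 'M[F]_n) : (0 < mxindex A)%N.
Proof. by rewrite /mxindex; case: ex_minnP => k /andP[]. Qed.

Lemma mxindex_stable (F : fieldType) (n : nat) (A : 'M[F]_n) :
  \rank (A ^+ (mxindex A).+1) = \rank (A ^+ mxindex A).
Proof. by rewrite /mxindex; case: ex_minnP => k /andP[_ /eqP]. Qed.

Lemma mxindex1P (F : fieldType) (n : nat) (A : 'M[F]_n) :
  mxindex A = 1%N <-> \rank (A ^+ 2) = \rank A.
Proof.
split=> [idxA | rkA]; first by rewrite -[RHS]/(\rank (A ^+ 1)) -idxA mxindex_stable idxA.
apply/eqP; rewrite eqn_leq mxindex_gt0 andbT /mxindex.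
by case: ex_minnP => k _; apply; rewrite /= expr1 rkA.
Qed.

Lemma mxindex0 (F : fieldType) (n : nat) : mxindex (0 : 'M[F]_n) = 1%N.
Proof. by apply/mxindex1P; rewrite expr0n. Qed.

(** The row spaces of the powers of [N] stop decreasing at the index, so if some
power vanishes, the power at the index does.  This turns nilpotency, which
leaves the exponent free, into the exponent prescribed by a core-EP
decomposition. *)
Lemma expmx_index_eq0 (F : fieldType) (n : nat) (N : 'M[F]_n) :
  nilpotent_mx N -> N ^+ mxindex N = 0.
Proof.
case=> k Nk0; set d := mxindex N.
have eqNd j : (N ^+ (d + j) :=: N ^+ d)%MS.
  elim: j => [|j IHj]; first by rewrite addn0.
  have eqNd1 : (N ^+ d.+1 :=: N ^+ d)%MS.
    apply/eqmxP; rewrite -(mxrank_leqif_eq _) ?mxindex_stable //.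
    by rewrite exprS -mulmxE submxMl.
  rewrite addnS exprSr -mulmxE; apply: eqmx_trans (eqmxMr _ IHj) _.
  by rewrite mulmxE -exprSr.
by apply/eqP; rewrite -submx0 -(eqNd k) exprD Nk0 mulr0 sub0mx.
Qed.

(** * The group inverse and the sharp order *)

(** Index one means that [M] and [M ^+ 2] have the same row space and the same
column space, so [M = Y *m M ^+ 2 = M ^+ 2 *m Z]; then [Y *m M *m Z] is a group
inverse. *)
Lemma group_inverse_exists (F : fieldType) (n : nat) (M : 'M[F]_n) :
  mxindex M = 1%N -> exists X, is_group_inverse M X.
Proof.
move/mxindex1P=> rkM.
have /submxP[Y defY] : (M <= M *m M)%MS.
  by rewrite -(mxrank_leqif_sup (submxMl M M)) -[M *m M]/(M ^+ 2) rkM.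
have /submxP[Z' defZ'] : (M^T <= (M *m M)^T)%MS.
  rewrite trmx_mul -(mxrank_leqif_sup (submxMl _ _)) -trmx_mul !mxrank_tr.
  by rewrite -[M *m M]/(M ^+ 2) rkM.
have {Z' defZ'} [Z defZ] : exists Z, M = M *m M *m Z.
  by exists Z'^T; rewrite -[LHS]trmxK defZ' trmx_mul trmxK.
have YM : Y *m M = M *m Z by rewrite {1}defZ (mulmxA Y) -defY.
have MYM : M *m Y *m M = M by rewrite -mulmxA YM mulmxA -defZ.
have MX : M *m (Y *m M *m Z) = M *m Z by rewrite !mulmxA MYM.
have XM : Y *m M *m Z *m M = Y *m M.
  by rewrite -(mulmxA Y) -YM -!mulmxA -defY.
exists (Y *m M *m Z); split.
- by rewrite -[M ^+ 2]/(M *m M) mulmxA XM -mulmxA -defY.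
- by rewrite XM -(mulmxA Y M) MX mulmxA.
- by rewrite MX XM YM.
Qed.

(** Multiplying the defining equations by powers of [M], or by powers of its
group inverse, which commutes with [M], exchanges them with equations that do
not mention the group inverse. *)
Lemma sharp_leP (F : fieldType) (n : nat) (M M' : 'M[F]_n) :
  sharp_le M M' <->
  [/\ mxindex M = 1%N, mxindex M' = 1%N, M *m M' = M *m M & M' *m M = M *m M].
Proof.
split=> [[idxM idxM' [X [[XMM XMX MX] eqMX eqXM]]] | [idxM idxM' MM' M'M]].
  rewrite -[M ^+ 2]/(M *m M) in XMM.
  have MMX : M *m M *m X = M by rewrite -mulmxA MX -{3}XMM !mulmxA MX.
  split=> //; first by rewrite -{1}MMX -mulmxA -eqXM mulmxA MMX.
  by rewrite -{1}XMM mulmxA -eqMX -mulmxA XMM.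
split=> //; have [X [XMM XMX MX]] := group_inverse_exists idxM.
have XE : X = M *m X *m X by rewrite MX.
have XE' : X = X *m X *m M by rewrite -mulmxA -MX mulmxA.
by exists X; split=> //; [rewrite XE !mulmxA M'M | rewrite XE' -!mulmxA MM'].
Qed.

(** * Unitary similarity *)

Section Unitary.
Variables (C : numClosedFieldType) (n : nat).
Implicit Types (U M : 'M[C]_n).

Definition uconj U M : 'M[C]_n := U *m M *m U ^t*.

Variable U : 'M[C]_n.
Hypothesis unitU : U \is unitarymx.

Lemma uconjM M N : uconj U (M *m N) = uconj U M *m uconj U N.
Proof. by rewrite /uconj !mulmxA mulmxKtV. Qed.

Lemma uconjD M N : uconj U (M + N) = uconj U M + uconj U N.
Proof. by rewrite /uconj mulmxDr mulmxDl. Qed.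

Lemma uconj0 : uconj U 0 = 0.
Proof. by rewrite /uconj mulmx0 mul0mx. Qed.

Lemma uconjX M k : uconj U (M ^+ k) = uconj U M ^+ k.
Proof.
elim: k => [|k IHk]; first by rewrite !expr0 /uconj mulmx1; apply/unitarymxP.
by rewrite !exprS -!mulmxE uconjM IHk.
Qed.

Lemma uconj_trC M : uconj U (M ^t*) = (uconj U M) ^t*.
Proof. by rewrite /uconj !(trmx_mul, map_mxM) trmxCK mulmxA. Qed.

Lemma uconjK M : uconj U (U ^t* *m M *m U) = M.
Proof.
have /unitarymxP UtU := unitU.
by rewrite /uconj !mulmxA UtU mul1mx -mulmxA UtU mulmx1.
Qed.

Lemma uconj_inj : injective (uconj U).
Proof.
have unitUt : U ^t* \is unitarymx by rewrite trmxC_unitary.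
apply: (can_inj (g := uconj (U ^t*))) => M.
by have /unitarymxP := unitUt; rewrite /uconj trmxCK !mulmxA => ->; rewrite mul1mx mulmxKtV.
Qed.

Lemma mxrank_uconj M : \rank (uconj U M) = \rank M.
Proof.
rewrite /uconj mxrankMfree; last first.
  by rewrite row_free_unit unitarymx_unit // trmxC_unitary.
by rewrite -mxrank_tr trmx_mul mxrankMfree ?mxrank_tr // row_free_unit unitmx_tr unitarymx_unit.
Qed.

Lemma mxindex_uconj M : mxindex (uconj U M) = mxindex M.
Proof. by apply: eq_mxindex => k; rewrite -!uconjX !mxrank_uconj. Qed.

Lemma core_EP_decomposition_uconj M M1 M2 :
  core_EP_decomposition (uconj U M) (uconj U M1) (uconj U M2) <->
  core_EP_decomposition M M1 M2.
Proof.
rewrite /core_EP_decomposition !mxindex_uconj -uconjD -uconjX -uconj_trC -!uconjM.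
have uconj_eq0 P : uconj U P = 0 -> P = 0 by rewrite -{1}uconj0 => /uconj_inj.
split=> [[/uconj_inj-> -> /uconj_eq0-> /uconj_eq0-> /uconj_eq0->] //|].
by case=> -> -> -> -> ->; rewrite uconj0.
Qed.

Lemma sharp_le_uconj M M' : sharp_le (uconj U M) (uconj U M') <-> sharp_le M M'.
Proof.
rewrite !sharp_leP !mxindex_uconj -!uconjM.
split=> [[-> -> /uconj_inj-> /uconj_inj->] //|]; by case=> -> -> -> ->.
Qed.

Lemma WG_le_uconj A B : WG_le (uconj U A) (uconj U B) <-> WG_le A B.
Proof.
split=> [[A1 [A2 [B1 [B2]]]] | [A1 [A2 [B1 [B2 [EPA EPB leAB]]]]]].
  rewrite -[A1]uconjK -[A2]uconjK -[B1]uconjK -[B2]uconjK.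
  case=> /core_EP_decomposition_uconj EPA /core_EP_decomposition_uconj EPB.
  by move=> /sharp_le_uconj leAB; do 4 eexists; split; [exact: EPA | exact: EPB |].
exists (uconj U A1), (uconj U A2), (uconj U B1), (uconj U B2).
by split; [apply/core_EP_decomposition_uconj.. | apply/sharp_le_uconj].
Qed.

End Unitary.

Lemma uconj_comp (C : numClosedFieldType) (n : nat) (U W M : 'M[C]_n) :
  uconj (U *m W) M = uconj U (uconj W M).
Proof. by rewrite /uconj trmx_mul map_mxM !mulmxA. Qed.

Section UnitaryCorner.
Variables (C : numClosedFieldType) (p m : nat) (V : 'M[C]_m).
Let W : 'M[C]_(p + m) := block_mx 1%:M 0 0 V.

Let WtE : W ^t* = block_mx 1%:M 0 0 (V ^t*).
Proof. by rewrite tr_block_mx map_block_mx !(trmx0, trmx1, map_mx0, map_mx1). Qed.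

Lemma unitary_corner_mx : V \is unitarymx -> W \is unitarymx.
Proof.
move=> unitV; apply/unitarymxP.
rewrite WtE mulmx_block !(mulmx0, mul0mx, addr0, add0r, mulmx1).
by rewrite (unitarymxP unitV) -scalar_mx_block.
Qed.

Lemma uconj_corner_mx (T : 'M[C]_p) (X : 'M[C]_(p, m)) (D : 'M[C]_m) :
  uconj W (block_mx T X 0 D) = block_mx T (X *m V ^t*) 0 (uconj V D).
Proof.
by rewrite /uconj WtE !mulmx_block !(mulmx0, mul0mx, addr0, add0r, mulmx1, mul1mx).
Qed.

End UnitaryCorner.

(** * Block triangular matrices with an invertible leading block *)

Section Block.
Variables (F : fieldType) (p m : nat).
Implicit Types (T : 'M[F]_p) (X : 'M[F]_(p, m)) (D : 'M[F]_m).

Lemma exp_ublock_mx T X D k :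
  exists Y, block_mx T X 0 D ^+ k = block_mx (T ^+ k) Y 0 (D ^+ k).
Proof.
elim: k => [|k [Y IHk]]; first by exists 0; rewrite !expr0 -scalar_mx_block.
exists (T *m Y + X *m D ^+ k).
by rewrite !exprS IHk -!mulmxE mulmx_block !(mul0mx, mulmx0) addr0 !add0r.
Qed.

(** An invertible right factor, [T X; 0 1], reduces to a block diagonal
matrix. *)
Lemma mxrank_ublock_mx T X D :
  T \in unitmx -> \rank (block_mx T X 0 D) = (p + \rank D)%N.
Proof.
move=> unitT; have -> : block_mx T X 0 D = block_mx 1%:M 0 0 D *m block_mx T X 0 1%:M.
  by rewrite mulmx_block !(mul0mx, mulmx0, mul1mx, mulmx1) !(addr0, add0r).
rewrite mxrankMfree ?rank_diag_block_mx ?mxrank1 //.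
by rewrite row_free_unit unitmxE det_ublock det1 mulr1 -unitmxE.
Qed.

(** The rank of the [k]-th power exceeds that of [D ^+ k] by the constant
[p]. *)
Lemma mxindex_ublock_mx T X D :
  T \in unitmx -> mxindex (block_mx T X 0 D) = mxindex D.
Proof.
move=> unitT; apply: eq_mxindex => k.
have unitTX j : T ^+ j \in unitmx.
  elim: j => [|j unitTj]; first exact: unitmx1.
  by rewrite exprS -mulmxE unitmx_mul unitT.
have [Y ->] := exp_ublock_mx T X D k; have [Y' ->] := exp_ublock_mx T X D k.+1.
by rewrite !mxrank_ublock_mx // eqn_add2l.
Qed.

(** By [sharp_leP], [B M = M M] forces the first block column of [B] to be that
of [M], and [M B = M M] then reads [T B12 + X Y = T X]; nothing but the index
condition restricts the last corner [Y]. *)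
Lemma sharp_le_ublock_mx T X (B : 'M[F]_(p + m)) :
    T \in unitmx ->
  sharp_le (block_mx T X 0 0) B <->
  exists2 Y, mxindex Y = 1%N & B = block_mx T (X - invmx T *m X *m Y) 0 Y.
Proof.
move=> unitT; rewrite sharp_leP; split=> [[_ idxB] | [Y idxY ->]].
  rewrite -[B]submxK in idxB *; set B11 := ulsubmx B in idxB *.
  set B12 := ursubmx B in idxB *; set B21 := dlsubmx B in idxB *.
  set Y := drsubmx B in idxB *.
  rewrite !mulmx_block !(mul0mx, mulmx0, addr0).
  move=> /eq_block_mx[_ eq12 _ _] /eq_block_mx[eq11 _ eq21 _].
  have {eq11} B11E : B11 = T by apply: (can_inj (mulmxK unitT)).
  have {eq21} B21E : B21 = 0 by rewrite -(mulmxK unitT B21) eq21 mul0mx.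
  have {eq12} B12E : B12 = X - invmx T *m X *m Y.
    by rewrite -[B12](mulKmx unitT) -[T *m B12](addrK (X *m Y)) eq12 mulmxBr mulKmx // mulmxA.
  rewrite B11E B12E B21E in idxB *.
  by exists Y; rewrite // -idxB mxindex_ublock_mx.
rewrite !mxindex_ublock_mx // mxindex0 idxY !mulmx_block !(mul0mx, mulmx0, addr0).
by split=> //; rewrite mulmxBr !mulmxA mulmxV // mul1mx subrK.
Qed.

End Block.

(** Since [T] is invertible, the first rows of [B1 ^t* *m B2 = 0] kill the first
rows of [B2], and the first columns of [B2 *m B1 = 0] kill its first columns.
The exponent that must annihilate [B2] is the same for the corner, because the
index ignores the invertible block. *)
Lemma core_EP_decomposition_ublock_mx (C : numClosedFieldType) (p m : nat)
    (T : 'M[C]_p) (X : 'M[C]_(p, m)) (Y : 'M[C]_m) (B B2 : 'M[C]_(p + m)) :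
    T \in unitmx ->
  core_EP_decomposition B (block_mx T X 0 Y) B2 <->
  exists D N, [/\ B = block_mx T X 0 D, B2 = block_mx 0 0 0 N
                & core_EP_decomposition D Y N].
Proof.
move=> unitT; have unitTt : T ^t* \in unitmx by rewrite map_unitmx unitmx_tr.
have trE : (block_mx T X 0 Y) ^t* = block_mx (T ^t*) 0 (X ^t*) (Y ^t*).
  by rewrite tr_block_mx map_block_mx !(trmx0, map_mx0).
have expE (N : 'M[C]_m) k : (0 < k)%N ->
    block_mx (0 : 'M_p) 0 0 N ^+ k = block_mx 0 0 0 (N ^+ k).
  case: k => // k _; elim: k => [|k IHk]; first by rewrite !expr1.
  by rewrite exprS IHk -mulmxE mulmx_block !(mul0mx, mulmx0, addr0, add0r) mulmxE -exprS.
split=> [[BE idxB1 B2X] | [D [N [-> -> [-> idxY NX YN NY]]]]]; last first.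
  rewrite /core_EP_decomposition !mxindex_ublock_mx // expE ?mxindex_gt0 // trE NX.
  rewrite !mulmx_block add_block_mx !(mul0mx, mulmx0, addr0, add0r) YN NY.
  by rewrite block_mx0.
rewrite trE -[B2]submxK in BE B2X *; set P := ulsubmx B2 in BE B2X *.
set Q := ursubmx B2 in BE B2X *; set R := dlsubmx B2 in BE B2X *.
set N := drsubmx B2 in BE B2X *.
rewrite !mulmx_block !(mul0mx, mulmx0, addr0) -!block_mx0.
move=> /eq_block_mx[P0 Q0 _ YN] /eq_block_mx[_ _ R0 NY].
have {}P0 : P = 0 by rewrite -(mulKmx unitTt P) P0 mulmx0.
have {}Q0 : Q = 0 by rewrite -(mulKmx unitTt Q) Q0 mulmx0.
have {}R0 : R = 0 by rewrite -(mulmxK unitT R) R0 mul0mx.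
rewrite P0 Q0 R0 in BE B2X YN NY *.
rewrite add_block_mx !addr0 in BE.
rewrite !(mulmx0, add0r, mul0mx) in YN NY.
exists (Y + N), N; split=> //; split=> //.
  by rewrite -idxB1 mxindex_ublock_mx.
move: B2X; rewrite BE mxindex_ublock_mx // expE ?mxindex_gt0 // -block_mx0.
by case/eq_block_mx.
Qed.

(** The base case, when no invertible block is left to strip. *)
Lemma core_EP_decomposition0P (C : numClosedFieldType) (n : nat) (D N : 'M[C]_n) :
  core_EP_decomposition D 0 N <-> D = N /\ nilpotent_mx N.
Proof.
split=> [[-> _ NX _ _] | [-> nilN]]; first by split; [rewrite add0r | exists (mxindex (0 + N))].
split; rewrite ?add0r ?mxindex0 ?mulmx0 ?expmx_index_eq0 //.
by rewrite trmx0 map_mx0 mul0mx.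
Qed.

(** * Canonical forms *)

(** In an orthonormal basis that begins with one of the column space of [M], the
last rows vanish.  The square of [T S; 0 0] factors through [T], so equality of
the ranks of [M] and [M ^+ 2] makes [T], whose size is the rank of [M], of full
rank. *)
Lemma index1_unitary_block (C : numClosedFieldType) (n : nat) (M : 'M[C]_n) :
    mxindex M = 1%N ->
  exists (p m : nat) (e : (p + m = n)%N) (U : 'M[C]_n) (T : 'M[C]_p) (S : 'M[C]_(p, m)),
    [/\ U \is unitarymx, T \in unitmx
      & M = uconj U (castmx (e, e) (block_mx T S 0 0))].
Proof.
move=> idxM.
have [p [m [e [W [unitW rkM WM0]]]]] : exists (p m : nat) (e : (p + m = n)%N)
    (W : 'M[C]_(p + m, n)), [/\ W \is unitarymx, \rank M = p & dsubmx (W *m M) = 0].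
  (* Rows of V are the conjugated columns of M; completing them orthonormally
     puts a basis of their orthogonal complement last. *)
  set V := M ^t*; do 2 eexists; exists (add_rank_ortho V), (schmidt_complete V); split.
  - exact: schmidt_complete_unitarymx.
  - by rewrite mxrank_map mxrank_tr.
  rewrite mul_col_mx col_mxKd; apply/eqP; rewrite -[M]trmxCK -/V -orthomx1E.
  by rewrite eqmx_schmidt_free ?row_base_free // eq_row_base.
case: _ / e => {n} in M idxM W unitW rkM WM0 *.
exists p, m, erefl, (W ^t* ).
have unitWt : W ^t* \is unitarymx by rewrite trmxC_unitary.
pose T := ulsubmx (W *m M *m W ^t*); pose S := ursubmx (W *m M *m W ^t*).
have WMWE : W *m M *m W ^t* = block_mx T S 0 0.
  have dWMW : dsubmx (W *m M *m W ^t*) = 0 by rewrite -mul_dsub_mx WM0 mul0mx.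
  by rewrite -[LHS]submxK /dlsubmx /drsubmx dWMW !(linear0).
have ME : M = uconj (W ^t*) (block_mx T S 0 0).
  by rewrite -WMWE; have := uconjK unitWt M; rewrite trmxCK => ->.
exists T, S; rewrite castmx_id; split=> //.
move/mxindex1P: idxM; rewrite ME -uconjX // !mxrank_uconj // => rkTS.
rewrite -row_full_unit /row_full eqn_leq rank_leq_col.
rewrite ME mxrank_uconj // in rkM; rewrite -{1}rkM -rkTS.
have -> : block_mx T S 0 0 ^+ 2 = col_mx T 0 *m row_mx T S.
  by rewrite expr2 -mulmxE mulmx_block mul_col_row !(mul0mx, mulmx0, addr0).
by rewrite (leq_trans (mxrankM_maxl _ _)) // rank_col_mx0.
Qed.

(** The canonical form with two rather than three block rows; the corner [N2]
of [B] and the whole corner [N] of [A] are what is left after stripping the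
invertible blocks. *)
Lemma WG_leP (C : numClosedFieldType) (n : nat) (A B : 'M[C]_n) :
  WG_le A B <->
  exists (p q r : nat) (e : (p + (q + r) = n)%N) (U : 'M[C]_n)
    (T : 'M[C]_p) (S : 'M[C]_(p, q + r)) (N : 'M[C]_(q + r))
    (T1 : 'M[C]_q) (S1 : 'M[C]_(q, r)) (N2 : 'M[C]_r),
    [/\ U \is unitarymx, T \in unitmx /\ T1 \in unitmx,
        nilpotent_mx N /\ nilpotent_mx N2,
        A = uconj U (castmx (e, e) (block_mx T S 0 N))
      & B = uconj U (castmx (e, e) (block_mx T
              (S - invmx T *m S *m block_mx T1 S1 0 0) 0 (block_mx T1 S1 0 N2)))].
Proof.
split; last first.
  move=> [p [q [r [e [U [T [S [N [T1 [S1 [N2 [unitU [unitT unitT1] [nilN nilN2] -> ->]]]]]]]]]]]].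
  apply/WG_le_uconj=> //; case: _ / e {U unitU}; rewrite !castmx_id.
  set Y := block_mx T1 S1 0 0; set X := S - _.
  exists (block_mx T S 0 0), (block_mx 0 0 0 N).
  exists (block_mx T X 0 Y), (block_mx 0 0 0 (block_mx 0 0 0 N2)).
  split.
  - apply/core_EP_decomposition_ublock_mx => //; exists N, N; split=> //.
    exact/core_EP_decomposition0P.
  - apply/core_EP_decomposition_ublock_mx => //; do 2 eexists; split=> //.
    apply/core_EP_decomposition_ublock_mx => //; exists N2, N2; split=> //.
    exact/core_EP_decomposition0P.
  - by apply/sharp_le_ublock_mx => //; exists Y; rewrite ?mxindex_ublock_mx ?mxindex0.
move=> [A1 [A2 [B1 [B2 [EPA EPB leAB]]]]].
have [p [m [e [U [T [S [unitU unitT A1E]]]]]]] : exists (p m : nat) (e : (p + m = n)%N)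
    (U : 'M[C]_n) (T : 'M[C]_p) (S : 'M[C]_(p, m)), [/\ U \is unitarymx, T \in unitmx
      & A1 = uconj U (castmx (e, e) (block_mx T S 0 0))].
  by case: EPA => _ + _ _ _; apply: index1_unitary_block.
case: _ / e => {n} in A B A1 A2 B1 B2 EPA EPB leAB U unitU A1E *.
move: EPA EPB leAB; rewrite {A1}A1E castmx_id.
(* Pass from each matrix to its coordinates in the new basis. *)
rewrite -(uconjK unitU A) -(uconjK unitU B) -(uconjK unitU A2).
rewrite -(uconjK unitU B1) -(uconjK unitU B2).
move: (_ *m A *m _) (_ *m B *m _) (_ *m A2 *m _) (_ *m B1 *m _) (_ *m B2 *m _).
move=> {}A {}B {}A2 {}B1 {}B2.
move=> /(core_EP_decomposition_uconj unitU) EPA /(core_EP_decomposition_uconj unitU) EPB.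
move=> /(sharp_le_uconj unitU)/(sharp_le_ublock_mx _ _ unitT)[Y idxY B1E].
rewrite {B1}B1E in EPB.
have [_ [N [-> _ /core_EP_decomposition0P[-> nilN]]]] :=
  (core_EP_decomposition_ublock_mx _ _ _ _ unitT).1 EPA.
have [D [D2 [-> _ EPD]]] := (core_EP_decomposition_ublock_mx _ _ _ _ unitT).1 EPB.
have [q [r [e [V [T1 [S1 [unitV unitT1 YE]]]]]]] := index1_unitary_block idxY.
case: _ / e => {m} in S N D D2 Y A A2 B B2 U unitU idxY EPA EPB nilN EPD V unitV YE *.
move: EPD; rewrite {Y idxY EPA EPB}YE castmx_id.
rewrite -(uconjK unitV D) -(uconjK unitV D2).
move: (_ *m D *m _) (_ *m D2 *m _) => {}D {}D2 /(core_EP_decomposition_uconj unitV).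
move=> /(core_EP_decomposition_ublock_mx _ _ _ _ unitT1).
move=> [_ [N2 [-> _ /core_EP_decomposition0P[-> nilN2]]]].
(* The second change of basis fixes the first p coordinates, hence T. *)
pose W := block_mx 1%:M 0 0 V : 'M[C]_(p + (q + r)).
exists p, q, r, erefl, (U *m W), T, (S *m V), (V ^t* *m N *m V), T1, S1, N2.
split=> //.
- exact/mul_unitarymx/unitary_corner_mx.
- split=> //; case: nilN => k Nk0; exists k; apply: (uconj_inj unitV).
  by rewrite uconjX // uconjK // Nk0 uconj0.
- by rewrite castmx_id uconj_comp uconj_corner_mx uconjK // mulmxtVK.
by rewrite castmx_id uconj_comp uconj_corner_mx mulmxBl mulmxtVK // /uconj !mulmxA.
Qed.

Theorem theorem4p2 (R : realType) (n : nat) (A B : 'M[R[i]]_n) :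
  WG_le A B <->
  exists (p q r : nat) (e : (p + (q + r) = n)%N) (U : 'M[R[i]]_n)
    (T : 'M[R[i]]_p) (S1h : 'M[R[i]]_(p, q)) (S2h : 'M[R[i]]_(p, r))
    (N11 : 'M[R[i]]_q) (N12 : 'M[R[i]]_(q, r))
    (N21 : 'M[R[i]]_(r, q)) (N22 : 'M[R[i]]_r)
    (T1 : 'M[R[i]]_q) (S1 : 'M[R[i]]_(q, r)) (N2 : 'M[R[i]]_r),
    [/\ U \is unitarymx,
        T \in unitmx /\ T1 \in unitmx,
        nilpotent_mx (block_mx N11 N12 N21 N22) /\ nilpotent_mx N2,
        A = U *m block3_mx e T   S1h S2h
                             0   N11 N12
                             0   N21 N22 *m U ^t*
      & B = U *m block3_mx e
                   T   (S1h - invmx T *m S1h *m T1) (S2h - invmx T *m S1h *m S1)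
                   0   T1                           S1
                   0   0                            N2 *m U ^t*].
Proof.
(* The partitioned correction terms are the partition of S - T^-1 S [T1 S1; 0 0]. *)
have blockE p q r (T : 'M[R[i]]_p) (S1h : 'M_(p, q)) (S2h : 'M_(p, r))
    (T1 : 'M_q) (S1 : 'M_(q, r)) :
    row_mx (S1h - invmx T *m S1h *m T1) (S2h - invmx T *m S1h *m S1) =
    row_mx S1h S2h - invmx T *m row_mx S1h S2h *m block_mx T1 S1 0 0.
  by rewrite mul_mx_row mul_row_block !mulmx0 !addr0 opp_row_mx add_row_mx.
rewrite WG_leP; split.
  move=> [p [q [r [e [U [T [S [N [T1 [S1 [N2 [unitU unitTT1 nilNN2 AE BE]]]]]]]]]]]].
  exists p, q, r, e, U, T, (lsubmx S), (rsubmx S).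
  exists (ulsubmx N), (ursubmx N), (dlsubmx N), (drsubmx N), T1, S1, N2.
  by rewrite /block3_mx blockE hsubmxK submxK !col_mx0.
move=> [p [q [r [e [U [T [S1h [S2h [N11 [N12 [N21 [N22 [T1 [S1 [N2]]]]]]]]]]]]]]].
rewrite /block3_mx blockE !col_mx0 => H.
by exists p, q, r, e, U, T, (row_mx S1h S2h), (block_mx N11 N12 N21 N22), T1, S1, N2.
Qed.
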